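(* Let $T$ be a metric space and let $X^*=\{X^*_t\}_{t\in T}$ be the Tawn–Molchanov (TM) process with ECF $\theta$. Then the following statements are equivalent: (i) $X^*$ is stochastically continuous. (ii) $\theta$ is continuous. (iii) The bivariate map $T\times T\ni(s,t)\mapsto\theta(\{s,t\})$ is continuous. (iv) The bivariate map $T\times T\ni(s,t)\mapsto\theta(\{s,t\})$ is continuous on the diagonal, i.e. at every point $(t,t)$, $t\in T$.
   Context: $\mathcal{F}(T)$ is the set of finite subsets of $T$. Simple max-stable process: a process $X=\{X_t\}_{t\in T}$ with $\mathbb{P}(X_t\le x)=e^{-1/x}$ for all $t\in T$, $x>0$, such that for every $n\in\mathbb{N}$ and independent copies $X^{(1)},\dots,X^{(n)}$ of $X$ the process $\{\bigvee_{i=1}^nX^{(i)}_t\}_{t\in T}$ has the same law (finite-dimensional distributions) as $\{nX_t\}_{t\in T}$. Extremal coefficient function (ECF) of a simple max-stable process $X$: $\theta:\mathcal{F}(T)\to[0,\infty)$ with $\theta(\varnothing)=0$ and $\theta(A)=-x\log\mathbb{P}(\bigvee_{t\in A}X_t\le x)$ for non-empty finite $A\subset T$ (independent of $x>0$). TM process with ECF $\theta$ (where $\theta$ is the ECF of some simple max-stable process on $T$): the simple max-stable process $X^*$ on $T$ (unique in law; its ECF is again $\theta$) with, for every non-empty finite $M\subset T$ and $x\in(0,\infty)^M$, $$-\log\mathbb{P}(X^*_t\le x_t,\ t\in M)=\sum_{\varnothing\neq L\subset M}\tau^M_L\bigvee_{t\in L}\frac1{x_t},\qquad \tau^M_L=\sum_{I\subset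 L}(-1)^{|I|+1}\theta\bigl((M\setminus L)\cup I\bigr).$$ Continuity of a set function: $f:\mathcal{F}(T)\to\mathbb{R}$ is called continuous if for every $m\ge0$ the induced function $f^{(m)}:T^m\to\mathbb{R}$, $f^{(m)}(t_1,\dots,t_m)=f(\{t_1,\dots,t_m\})$, is continuous for the product topology on $T^m$. A process $X$ on $T$ is stochastically continuous if for every $\varepsilon>0$, every $t\in T$ and every sequence $t^{(n)}\to t$ in $T$, $\mathbb{P}(|X_{t^{(n)}}-X_t|>\varepsilon)\to0$. *)

(* Defs.v *)
From mathcomp Require Import all_boot all_order all_algebra finmap.
From mathcomp Require Import all_classical all_reals all_analysis.
Set Implicit Arguments.
Unset Strict Implicit.
Unset Printing Implicit Defensive.
Import Order.TTheory GRing.Theory Num.Theory.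
Import numFieldNormedType.Exports.
Local Open Scope classical_set_scope.
Local Open Scope ring_scope.

(* The two processes may live on different probability spaces; [B] ranges over
   the Borel sets of R^m. *)
Definition same_fdd (R : realType) (T : Type)
    (d : measure_display) (W : measurableType d) (P : probability W R)
    (X : T -> W -> R)
    (d' : measure_display) (W' : measurableType d') (P' : probability W' R)
    (X' : T -> W' -> R) : Prop :=
  forall (m : nat) (t : m.-tuple T) (B : set (m.-tuple R)), measurable B ->
    P [set w | B [tuple X (tnth t i) w | i < m]] =
    P' [set w | B [tuple X' (tnth t i) w | i < m]].

Definition sigma_process (R : realType) (T : Type)
    (d : measure_display) (W : measurableType d) (X : T -> W -> R) :
    set (set W) :=
  <<s [set E | exists (t : T) (B : set R), measurable B /\ E = X t @^-1` B] >>.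

(* Since each E i may be the whole space, the product rule for all n indices
   contains the product rule for every subfamily. *)
Definition independent_processes (R : realType) (T : Type)
    (d : measure_display) (W : measurableType d) (P : probability W R)
    (n : nat) (Y : 'I_n -> T -> W -> R) : Prop :=
  forall E : 'I_n -> set W, (forall i, sigma_process (Y i) (E i)) ->
    P (\bigcap_(i in [set: 'I_n]) E i) = (\prod_(i < n) P (E i))%E.

(* The number of copies is n.+1 >= 1; the default value Y ord0 t w of the
   iterated maximum is one of its terms. *)
Definition simple_max_stable (R : realType) (T : Type)
    (d : measure_display) (W : measurableType d) (P : probability W R)
    (X : T -> {RV P >-> R}) : Prop :=
  (forall (t : T) (x : R), 0 < x ->
     P [set w | X t w <= x] = (expR (- x^-1))%:E) /\
  (forall (n : nat) (d' : measure_display) (W' : measurableType d')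
      (P' : probability W' R) (Y : 'I_n.+1 -> T -> {RV P' >-> R}),
     independent_processes P' (fun i t => Y i t : W' -> R) ->
     (forall i, same_fdd P' (fun t => Y i t : W' -> R)
                         P (fun t => X t : W -> R)) ->
     same_fdd
       P' (fun t w => \big[Num.max/Y ord0 t w]_(i < n.+1) Y i t w)
       P (fun t w => n.+1%:R * X t w)).
Arguments simple_max_stable {R T d W} P X.

(* The maximum over A is taken in \bar R, where -oo is its neutral element. *)
Definition is_ecf (R : realType) (T : choiceType)
    (d : measure_display) (W : measurableType d) (P : probability W R)
    (X : T -> {RV P >-> R}) (theta : {fset T} -> R) : Prop :=
  [/\ forall A : {fset T}, 0 <= theta A,
      theta fset0 = 0
    & forall A : {fset T}, A != fset0 -> forall x : R, 0 < x ->
        (theta A)%:E =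
        (- x%:E *
           lne (P [set w | \big[maxe/-oo]_(t <- A) (X t w)%:E <= x%:E]))%E].
Arguments is_ecf {R T d W} P X theta.

Definition tau (R : realType) (T : choiceType) (theta : {fset T} -> R)
    (M L : {fset T}) : R :=
  \sum_(I <- fpowerset L)
    (-1) ^+ (#|` I|).+1 * theta ((M `\` L) `|` I)%fset.

(* A point x of (0, oo)^M is given by any x : T -> R that is positive
   on M, so that 0 is a neutral default for the maxima of 1 / x_t. *)
Definition is_TM_process (R : realType) (T : choiceType)
    (d : measure_display) (W : measurableType d) (P : probability W R)
    (X : T -> {RV P >-> R}) (theta : {fset T} -> R) : Prop :=
  [/\ exists (d0 : measure_display) (W0 : measurableType d0)
        (P0 : probability W0 R) (X0 : T -> {RV P0 >-> R}),
        simple_max_stable P0 X0 /\ is_ecf P0 X0 theta,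
      simple_max_stable P X
    & forall (M : {fset T}) (x : T -> R), M != fset0 ->
        (forall t, t \in M -> 0 < x t) ->
        (- lne (P [set w | forall t, t \in M -> (X t w <= x t)%R]))%E =
        (\sum_(L <- fpowerset M | L != fset0)
            tau theta M L * \big[Num.max/0]_(t <- L) (x t)^-1)%:E].
Arguments is_TM_process {R T d W} P X theta.

Definition stochastically_continuous (R : realType) (T : topologicalType)
    (d : measure_display) (W : measurableType d) (P : probability W R)
    (X : T -> {RV P >-> R}) : Prop :=
  forall (eps : R) (t : T) (u : nat -> T), 0 < eps -> u @ \oo --> t ->
    P [set w | eps < `|X (u n) w - X t w|] @[n --> \oo] --> 0%E.
Arguments stochastically_continuous {R T d W} P X.

Definition continuous_set_function (R : realType) (T : topologicalType)
    (f : {fset T} -> R) : Prop :=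
  forall m : nat,
    continuous (fun t : {ptws 'I_m -> T} => f [fset t i | i : 'I_m]%fset).

(* Main.v *)
(* Everything is read off the events {X_t <= x}. Since
   P(X_u <= 1 for all u in A) = exp(-theta A), a union bound gives, for tuples s
   and t of the same length,
     |exp(-theta{s_i}) - exp(-theta{t_i})| <= sum_i (exp(-1) - exp(-theta{s_i,t_i})),
   so theta is continuous as soon as theta{s,t} -> theta{t} = 1 when s -> t.
   For the TM process, P(X_s <= x < X_t) = exp(-1/x) - exp(-theta{s,t}/x).
   If X_t - X_s > eps with X_s > 0, then a multiple x of eps separates X_s and
   X_t; letting x range over a finite grid, up to which the tail of X_t is small,
   shows that theta{s,t} -> 1 implies stochastic continuity. Conversely
   P(X_s <= 1 < X_t) <= P(|X_s - X_t| > eps) + P(1 < X_t <= 1 + eps). *)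
Require Import Defs.
From mathcomp Require Import all_boot all_order all_algebra finmap.
From mathcomp Require Import ring lra.
From mathcomp Require Import all_classical all_reals all_analysis.
From mathcomp Require Import measurable_realfun.
Import Order.TTheory GRing.Theory Num.Theory.
Import numFieldNormedType.Exports.
Local Open Scope classical_set_scope.
Local Open Scope ring_scope.

Set Implicit Arguments.
Unset Strict Implicit.

(** * Events of the form [X t w <= x] and a union bound *)

Section Law.
Context (R : realType) (d : measure_display) (W : measurableType d)
  (P : probability W R).

(** Undoes the logarithm in which both the ECF and the TM law are given; [lne] is injective on the
    nonnegative extended reals, so [P A] may a priori vanish. *)
Lemma oppe_lne_probability (A : set W) (r : R) :
  (- lne (P A))%E = r%:E -> P A = (expR (- r))%:E.
Proof.
move=> Ar; have : lne (P A) = (- r)%:E by rewrite EFinN -Ar oppeK.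
by move=> /(congr1 expeR); rewrite lneK// in_itv/= measure_ge0 leey.
Qed.

Lemma probability_setD (A B : set W) (a b : R) : measurable A -> measurable B ->
  P A = a%:E -> P (A `&` B) = b%:E -> P (A `\` B) = (a - b)%:E.
Proof.
move=> mA mB PA PAB; have : P A = (P (A `\` B) + P (A `&` B))%E by exact: measureDI.
rewrite PA PAB.
have /fineK <- : P (A `\` B) \is a fin_num.
  by apply: fin_num_measure; exact: measurableD.
by rewrite -EFinD => -[->]; rewrite addrK.
Qed.

(** The shape of every estimate below: one exceptional event [B], known up to a bound, and finitely
    many events of known probability. *)
Lemma le_probability_bigcup (n : nat) (A B : set W) (F : 'I_n -> set W)
    (b : R) (f : 'I_n -> R) :
  measurable A -> measurable B -> (forall i, measurable (F i)) ->
  (P B <= b%:E)%E -> (forall i, P (F i) = (f i)%:E) ->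
  (forall w, A w -> B w \/ exists i, F i w) ->
  (P A <= (b + \sum_(i < n) f i)%:E)%E.
Proof.
move=> mA mB mF PB PF AF.
(* [B] takes index 0 and [F i] index [i.+1], so that subadditivity of one sequence applies; later
   indices get the empty set. *)
pose G k := if k is k'.+1 then
  if insub k' is Some i then F i else set0 else B.
have mG k : measurable (G k).
  by case: k => //= k; case: insubP => // *; exact: mF.
have GS (i : 'I_n) : G i.+1 = F i by rewrite /G valK.
have sAG : A `<=` \big[setU/set0]_(k < n.+1) G k.
  move=> w /AF[Bw|[i Fiw]]; rewrite -(bigcup_mkord _ G); first by exists 0%N.
  by exists i.+1; rewrite ?GS//= ltnS.
have := @content_subadditive _ _ _ P A G n.+1 (fun k _ => mG k) mA sAG.
move=> /le_trans; apply; rewrite big_ord_recl EFinD -sumEFin leeD//.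
by apply: lee_sum => i _; rewrite GS -PF.
Qed.

Lemma measurable_le_RV (X : {RV P >-> R}) (x : R) :
  measurable [set w | X w <= x].
Proof.
rewrite (_ : [set w | _] = X @^-1` `]-oo, x]%classic).
  exact: measurable_funPTI.
by apply/seteqP; split=> w /=; rewrite in_itv.
Qed.

Lemma measurable_forall_le (T : choiceType) (X : T -> {RV P >-> R})
  (A : {fset T}) (x : R) :
  measurable [set w | forall t, t \in A -> X t w <= x].
Proof.
rewrite (_ : [set w | _] = \bigcap_(t in [set` A]) [set w | X t w <= x]).
  by apply: fin_bigcap_measurable => // t _; exact: measurable_le_RV.
by apply/seteqP; split=> w /= Aw t; exact: Aw.
Qed.

Lemma ecf_probability (T : choiceType) (X : T -> {RV P >-> R})
    (theta : {fset T} -> R) (A : {fset T}) :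
  is_ecf P X theta -> A != fset0 ->
  P [set w | forall t, t \in A -> X t w <= 1] = (expR (- theta A))%:E.
Proof.
move=> [_ _ ecf] A0; have := ecf A A0 1 ltr01; rewrite mulNe mul1e => /esym.
move/oppe_lne_probability <-; congr (P _).
apply/seteqP; split=> w /= Aw.
  rewrite big_seq; apply: bigmax_le => [|t tA]; first exact: leNye.
  by rewrite lee_fin Aw.
move=> t tA; rewrite -lee_fin; apply: le_trans Aw.
by apply: (@le_bigmax_seq _ _ _ _ _ t xpredT (fun t => (X t w)%:E)).
Qed.

End Law.

(** * Sums over the subsets of sets with one or two points *)

Lemma sum_fpowerset1 (T : choiceType) (V : nmodType) (s : T)
    (f : {fset T} -> V) :
  \sum_(I <- fpowerset [fset s]%fset) f I = f fset0 + f [fset s]%fset.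
Proof.
rewrite fpowerset1 big_fsetU1/= ?big_seq_fset1// inE.
by apply/eqP => /fsetP/(_ s); rewrite !inE eqxx.
Qed.

Lemma sum_fpowerset2 (T : choiceType) (V : nmodType) (s t : T)
  (f : {fset T} -> V) : s != t ->
  \sum_(I <- fpowerset [fset s; t]%fset) f I =
  f fset0 + f [fset s]%fset + f [fset t]%fset + f [fset s; t]%fset.
Proof.
move=> st; rewrite (perm_big [:: fset0; [fset s]; [fset t]; [fset s; t]]%fset)/=.
  by rewrite !big_cons big_nil addr0 !addrA.
apply: uniq_perm; first exact: fset_uniq.
  rewrite /= !inE !negb_or andbT -!andbA.
  by do !(apply/andP; split); apply/eqP => /fsetP E; move: (E s) (E t);
     rewrite !inE ?eqxx ?(negbTE st) 1?eq_sym ?(negbTE st).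
move=> L; rewrite fpowersetE !inE.
apply/idP/idP => [/fsubsetP Lst|]; last first.
  by case/or4P => /eqP ->; rewrite ?fsub0set ?fsubset_refl// fsub1set !inE eqxx ?orbT.
(* A subset of the pair is determined by whether it contains [s] and whether it contains [t]. *)
have LE : L = ((if s \in L then [fset s] else fset0) `|`
               (if t \in L then [fset t] else fset0))%fset.
  apply/fsetP => x; rewrite inE.
  have [xL|xL] := boolP (x \in L).
    have := Lst _ xL; rewrite !inE => /orP[]/eqP E; subst x.
      by rewrite xL inE eqxx.
    by rewrite xL inE eqxx orbT.
  apply/esym/negbTE; rewrite negb_or.
  by apply/andP; split; case: ifP => H; rewrite inE//;
     apply: contraNneq xL => ->.
rewrite LE; case: ifP => _; case: ifP => _; rewrite ?fsetU0 ?fset0U ?eqxx ?orbT//.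
Qed.

Lemma bigmax_const (R : realType) (T : choiceType) (L : {fset T}) (c : R) :
  0 <= c -> L != fset0 -> \big[Num.max/0]_(t <- L) c = c.
Proof.
move=> c0 /fset0Pn[t tL]; apply/le_anti/andP; split; first exact: bigmax_le.
by apply: (@le_bigmax_seq _ _ _ _ _ t xpredT (fun=> c)).
Qed.

(** * Extremal coefficients of a TM process and their continuity *)

Section TM.
Context (R : realType) (T : choiceType) (d : measure_display)
  (W : measurableType d) (P : probability W R) (X : T -> {RV P >-> R})
  (theta : {fset T} -> R).

Lemma TM_ecf0 : is_TM_process P X theta -> theta fset0 = 0.
Proof. by move=> [[? [? [? [? [_ []]]]]]]. Qed.

Lemma TM_ecf1 (t : T) : is_TM_process P X theta -> theta [fset t]%fset = 1.
Proof.
move=> [[d0 [W0 [P0 [X0 [[marg _] ecf]]]]] _ _].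
have t0 : [fset t]%fset != fset0 by apply/fset0Pn; exists t; rewrite inE.
have := ecf_probability ecf t0.
rewrite (_ : [set w | _] = [set w | X0 t w <= 1]); last first.
  apply/seteqP; split=> w /=; first by apply; rewrite inE.
  by move=> Xt u; rewrite inE => /eqP ->.
by rewrite marg// invr1 => -[/expR_inj/oppr_inj].
Qed.

(** At a constant level every maximum in the TM formula equals [x^-1], and the coefficients [tau]
    add up to the extremal coefficient of the pair. *)
Lemma TM_ecf2_probability (s t : T) (x : R) :
  is_TM_process P X theta -> 0 < x ->
  P ([set w | X s w <= x] `&` [set w | X t w <= x]) =
  (expR (- (theta [fset s; t]%fset / x)))%:E.
Proof.
move=> TMX x0; have [<-|st] := eqVneq s t.
  rewrite setIid fsetUid TM_ecf1// div1r.
  by case: TMX => _ [marg _] _; exact: marg.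
have M0 : [fset s; t]%fset != fset0 by apply/fset0Pn; exists s; rewrite !inE eqxx.
have th0 := TM_ecf0 TMX; have ths := TM_ecf1 s TMX; have tht := TM_ecf1 t TMX.
case: TMX => _ _ /(_ _ (fun=> x) M0 (fun _ _ => x0)) /oppe_lne_probability.
rewrite (_ : [set w | _] =
  [set w | X s w <= x] `&` [set w | X t w <= x]); last first.
  apply/seteqP; split=> w /=.
    by move=> H; split; apply: H; rewrite !inE eqxx ?orbT.
  by move=> [? ?] u; rewrite !inE => /orP[]/eqP ->.
move=> ->; congr (expR (- _))%:E; rewrite big_mkcond sum_fpowerset2//= add0r.
have xV0 : 0 <= x^-1 by rewrite invr_ge0 ltW.
have s0 : [fset s]%fset != fset0 by apply/fset0Pn; exists s; rewrite inE.
have t0 : [fset t]%fset != fset0 by apply/fset0Pn; exists t; rewrite inE.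
rewrite !s0 t0 M0 !bigmax_const// -!mulrDl; congr (_ / x).
(* With M = {s,t}: tau at {s} is theta(M) - theta{t}, at {t} it is theta(M) - theta{s}, and at M it
   is theta{s} + theta{t} - theta(M), since [theta fset0] is 0. *)
rewrite /tau sum_fpowerset2// !sum_fpowerset1.
have -> : ([fset s; t] `\` [fset s] = [fset t])%fset.
  apply/fsetP => u; rewrite !inE.
  by have [->|] := eqVneq u s => //=; rewrite (negbTE st).
have -> : ([fset s; t] `\` [fset t] = [fset s])%fset.
  apply/fsetP => u; rewrite !inE.
  have [->|] := eqVneq u t => //=; last by rewrite orbF.
  by rewrite eq_sym (negbTE st).
rewrite fsetDv !fset0U !fsetU0 th0 ths tht (fsetUC [fset t]%fset).
rewrite cardfs0 !cardfs1 cardfs2 st /=; ring.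
Qed.

(** If every [s i] has value at most 1, then so does every [t i], or some index has its value at
    [s i] at most 1 and its value at [t i] above 1. The process [X0] is used because its ECF gives
    the joint probabilities for all finite sets at once. *)
Lemma TM_expR_ecf_le (m : nat) (s t : 'I_m -> T) : is_TM_process P X theta ->
  expR (- theta [fset s i | i : 'I_m]%fset) <=
  expR (- theta [fset t i | i : 'I_m]%fset) +
  \sum_(i < m) (expR (-1) - expR (- theta [fset s i; t i]%fset)).
Proof.
move=> [[d0 [W0 [P0 [X0 [[marg _] ecf]]]]] _ _].
(* The empty tuple is treated apart, since the ECF formula concerns non-empty sets. *)
case: m s t => [|m] s t.
  have E (r : 'I_0 -> T) : [fset r i | i : 'I_0]%fset = fset0.
    by apply/fsetP => u; rewrite inE; apply/imfsetP => -[[]].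
  by rewrite !E big_ord0 addr0.
have E0 (r : 'I_m.+1 -> T) : [fset r i | i : 'I_m.+1]%fset != fset0.
  by apply/fset0Pn; exists (r ord0); exact: in_imfset.
have E2 u v : [fset u; v]%fset != fset0 :> {fset T}.
  by apply/fset0Pn; exists u; rewrite !inE eqxx.
rewrite -lee_fin -(ecf_probability ecf (E0 s)).
apply: (@le_probability_bigcup _ _ _ _ _ _
  [set w | forall u, u \in [fset t i | i : 'I_m.+1]%fset -> X0 u w <= 1]
  (fun i => [set w | X0 (s i) w <= 1] `\` [set w | X0 (t i) w <= 1])).
- exact: measurable_forall_le.
- exact: measurable_forall_le.
- by move=> i; apply: measurableD; exact: measurable_le_RV.
- by rewrite -(ecf_probability ecf (E0 t)).
- move=> i; apply: probability_setD; try exact: measurable_le_RV.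
    by rewrite marg// invr1.
  rewrite -(ecf_probability ecf (E2 (s i) (t i))); congr (P0 _).
  apply/seteqP; split=> w /=.
    by move=> [? ?] u; rewrite !inE => /orP[]/eqP ->.
  by move=> H; split; apply: H; rewrite !inE eqxx ?orbT.
- move=> w /= sw; have [tw|] := pselect (forall i, X0 (t i) w <= 1).
    by left=> u /imfsetP[i _ ->].
  move=> /existsNP[i /negP]; right; exists i; split=> /=; last exact/negP.
  by apply: sw; exact: in_imfset.
Qed.

(* [S] stands for the neighborhood filters of a topology on [T]. *)
Lemma TM_ecf_cvg (S : T -> set_system T) (I : Type) (F : set_system I) (m : nat)
    (f : 'I_m -> I -> T) (t : 'I_m -> T) : Filter F -> is_TM_process P X theta ->
  (forall u, expR (- theta [fset v; u]%fset) @[v --> S u] --> expR (-1)) ->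
  (forall i, f i x @[x --> F] --> S (t i)) ->
  theta [fset f i x | i : 'I_m]%fset @[x --> F] -->
  theta [fset t i | i : 'I_m]%fset.
Proof.
move=> FF TMX H ft.
pose e x := \sum_(i < m) (expR (-1) - expR (- theta [fset f i x; t i]%fset)).
have e0 : e x @[x --> F] --> (0 : R).
  rewrite [X in _ --> X](_ : 0 = \sum_(i < m) (0 : R)); last by rewrite big1.
  apply: cvg_big; first exact: add_continuous.
  move=> i _; rewrite -(subrr (expR (-1))); apply: cvgB; first exact: cvg_cst.
  by apply: cvg_comp (H (t i)); exact: ft.
have expH : expR (- theta [fset f i x | i : 'I_m]%fset) @[x --> F] -->
            expR (- theta [fset t i | i : 'I_m]%fset).
  set E := expR (- theta [fset t i | i : 'I_m]%fset).
  apply: (@squeeze_cvgr _ _ _ _ (fun x => E - e x) (fun x => E + e x)).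
  (* The lower bound is the same inequality with the two tuples exchanged; the error does not
     change, as pairs are unordered. *)
  - apply: nearW => x; rewrite lerBlDr !TM_expR_ecf_le ?andbT//.
    have := TM_expR_ecf_le t (fun i => f i x) TMX.
    by under eq_bigr do rewrite fsetUC.
  - by rewrite -[X in _ --> X]subr0; apply: cvgB => //; exact: cvg_cst.
  - by rewrite -[X in _ --> X]addr0; apply: cvgD => //; exact: cvg_cst.
have lnK A : theta A = - ln (expR (- theta A)) by rewrite expRK opprK.
rewrite lnK; under eq_fun do rewrite lnK.
by apply: cvgN; apply: continuous_cvg => //; apply: continuous_ln; exact: expR_gt0.
Qed.

End TM.

(** * Bounds between pair coefficients and the law of [|X s w - X t w|] *)

Section StochasticContinuity.
Context (R : realType) (T : choiceType) (d : measure_display)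
  (W : measurableType d) (P : probability W R) (X : T -> {RV P >-> R})
  (theta : {fset T} -> R).

Lemma measurable_dist_gt (s t : T) (eps : R) :
  measurable [set w | eps < `|X s w - X t w|].
Proof.
have mst : measurable_fun setT (fun w => `|X s w - X t w|).
  by apply: measurableT_comp => //; exact: measurable_funB.
rewrite (_ : [set w | _] =
  setT `&` (fun w => `|X s w - X t w|) @^-1` `]eps, +oo[%classic).
  exact: mst.
by rewrite setTI; apply/seteqP; split=> w /=; rewrite in_itv/= andbT.
Qed.

Lemma measurable_increment (s t : T) (eps : R) :
  measurable [set w | X s w + eps < X t w].
Proof.
have mst : measurable_fun setT (fun w => X t w - X s w) by exact: measurable_funB.
rewrite (_ : [set w | _] =
  setT `&` (fun w => X t w - X s w) @^-1` `]eps, +oo[%classic).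
  exact: mst.
by rewrite setTI; apply/seteqP; split=> w /=; rewrite in_itv/= andbT ltrBrDl.
Qed.

Lemma TM_setD_probability (s t : T) (x : R) : is_TM_process P X theta -> 0 < x ->
  P ([set w | X s w <= x] `\` [set w | X t w <= x]) =
  (expR (- x^-1) - expR (- (theta [fset s; t]%fset / x)))%:E.
Proof.
move=> TMX x0; apply: probability_setD; try exact: measurable_le_RV.
  by case: TMX => _ [marg _] _; exact: marg.
exact: TM_ecf2_probability.
Qed.

(** The left side is the probability that X_s <= 1 < X_t. On this event, either the distance exceeds
    [eps] or 1 < X_t <= 1 + [eps]. *)
Lemma TM_ecf_le_dist (s t : T) (eps : R) : is_TM_process P X theta -> 0 < eps ->
  expR (-1) - expR (- theta [fset s; t]%fset) <=
  fine (P [set w | eps < `|X s w - X t w|]) + eps.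
Proof.
move=> TMX e0.
have e1 : 0 < 1 + eps by lra.
(* With a = 1/(1 + eps), the difference is e^(-a) (1 - e^(a-1)), at most e^(-a) (1 - a), where 1 - a
   <= eps and e^(-a) <= 1. *)
have expR_eps : expR (- (1 + eps)^-1) - expR (-1) <= eps.
  have a0 : 0 < (1 + eps)^-1 by rewrite invr_gt0.
  have a1 : 1 - eps <= (1 + eps)^-1.
    rewrite -[leRHS]mul1r ler_pdivlMr//; nra.
  have -> : expR (-1) = expR (- (1 + eps)^-1) * expR ((1 + eps)^-1 - 1) :> R.
    by rewrite -expRD; congr expR; lra.
  have := expR_ge1Dx ((1 + eps)^-1 - 1); set y := expR (_ - 1) => y1.
  have : expR (- (1 + eps)^-1) <= 1 by rewrite expR_le1 oppr_le0 ltW.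
  have := expR_gt0 (- (1 + eps)^-1); set x := expR _ => x0 x1; nra.
have := TM_setD_probability s t TMX ltr01; rewrite invr1 mulr1 => Pst.
have marg : forall x, 0 < x -> P [set w | X t w <= x] = (expR (- x^-1))%:E.
  by case: TMX => _ [marg _] _ x; exact: marg.
have Ptt : P ([set w | X t w <= 1 + eps] `\` [set w | X t w <= 1]) =
    (expR (- (1 + eps)^-1) - expR (-1))%:E.
  apply: probability_setD; try exact: measurable_le_RV; first exact: marg.
  rewrite (_ : _ `&` _ = [set w | X t w <= 1]) ?marg ?invr1//.
  by apply/seteqP; split=> w /=; [case|split=> //; lra].
rewrite -lee_fin -Pst.
have := @le_probability_bigcup _ _ _ P 1
  ([set w | X s w <= 1] `\` [set w | X t w <= 1])
  [set w | eps < `|X s w - X t w|]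
  (fun=> [set w | X t w <= 1 + eps] `\` [set w | X t w <= 1])
  (fine (P [set w | eps < `|X s w - X t w|]))
  (fun=> expR (- (1 + eps)^-1) - expR (-1)).
rewrite big_ord1 => H; apply: le_trans (H _ _ _ _ _ _) _;
  last by rewrite lee_fin lerD2l.
- by apply: measurableD; exact: measurable_le_RV.
- exact: measurable_dist_gt.
- by move=> _; apply: measurableD; exact: measurable_le_RV.
- by rewrite fineK//; apply: fin_num_measure; exact: measurable_dist_gt.
- by move=> _.
- move=> w /= [sw /negP]; rewrite -ltNge => tw.
  have [Xst|Xst] := ltP eps `|X s w - X t w|; first by left.
  right; exists ord0; split; last by apply/negP; rewrite -ltNge.
  by move: Xst; rewrite distrC ler_norml => /andP[_]; lra.
Qed.

(** The marginal law is prescribed at positive levels only; the level [e] tends to 0, with exp(-1/e)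
    <= e. *)
Lemma TM_le0 (t : T) : is_TM_process P X theta -> P [set w | X t w <= 0] = 0%E.
Proof.
move=> TMX; apply/eqP; rewrite eq_le measure_ge0 andbT.
apply/lee_addgt0Pr => e e0; rewrite add0e.
apply: (@le_trans _ _ (P [set w | X t w <= e])).
  apply: le_measure; rewrite ?inE; try exact: measurable_le_RV.
  by move=> w /= /le_trans; apply; exact: ltW.
case: TMX => _ [marg _] _; rewrite marg// lee_fin expRN invf_ple ?posrE ?expR_gt0//.
by rewrite (le_trans _ (expR_ge1Dx _))// lerDr.
Qed.

Lemma TM_gt_le (t : T) (x : R) : is_TM_process P X theta -> 0 < x ->
  (P [set w | (x < X t w)%R] <= (x^-1)%:E)%E.
Proof.
move=> [_ [marg _] _] x0.
rewrite (_ : [set w | _] = ~` [set w | X t w <= x]); last first.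
  by apply/seteqP; split=> w /=; rewrite ltNge => /negP.
rewrite probability_setC; last exact: measurable_le_RV.
by rewrite marg// -EFinB lee_fin lerBlDr -lerBlDl expR_ge1Dx.
Qed.

(** Off the null event X_s <= 0 and the tail event X_t > K eps, one of the levels eps, 2 eps, ..., K
    eps separates X_s from X_t. *)
Lemma TM_increment_le (s t : T) (eps : R) (K : nat) :
  is_TM_process P X theta -> 0 < eps -> (0 < K)%N ->
  (P [set w | (X s w + eps < X t w)%R] <= ((K%:R * eps)^-1 +
    \sum_(k < K) (expR (- (k.+1%:R * eps)^-1) -
                  expR (- (theta [fset s; t]%fset / (k.+1%:R * eps)))))%:E)%E.
Proof.
move=> TMX e0 K0.
have k0 (k : nat) : 0 < k.+1%:R * eps by rewrite mulr_gt0.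
have Ke0 : 0 < K%:R * eps by rewrite mulr_gt0// ltr0n.
have mgt x : measurable [set w | x < X t w].
  rewrite (_ : [set w | _] = ~` [set w | X t w <= x]); last first.
    by apply/seteqP; split=> w /=; rewrite ltNge => /negP.
  by apply: measurableC; exact: measurable_le_RV.
apply: (@le_probability_bigcup _ _ _ _ _ _
  ([set w | X s w <= 0] `|` [set w | K%:R * eps < X t w])
  (fun k => [set w | X s w <= k.+1%:R * eps] `\`
            [set w | X t w <= k.+1%:R * eps])).
- exact: measurable_increment.
- by apply: measurableU => //; exact: measurable_le_RV.
- by move=> k; apply: measurableD; exact: measurable_le_RV.
- apply: le_trans (measureU2 _ _ _) _ => //; first exact: measurable_le_RV.
  by rewrite [X in (X + _)%E](TM_le0 s TMX) add0e; exact: TM_gt_le.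
- by move=> k; exact: TM_setD_probability.
- move=> w /= st.
  have [s0|s0] := leP (X s w) 0; first by left; left.
  have [tK|tK] := ltP (K%:R * eps) (X t w); first by left; right.
  right; have se0 : 0 <= X s w / eps by rewrite divr_ge0// ltW.
  (* For k the integer part of X_s / eps, the level (k+1) eps exceeds X_s by at most eps, hence
     stays below X_t. *)
  have /andP[] := truncn_itv se0.
  set k := Num.truncn _; rewrite ler_pdivlMr// ltr_pdivrMr// => ks sk.
  have kt : k.+1%:R * eps < X t w.
    by rewrite -natr1 mulrDl mul1r (le_lt_trans _ st)// lerD2r.
  have kK : (k < K)%N.
    rewrite -(ltr_nat R) -(ltr_pM2r e0) (lt_le_trans _ tK)// (le_lt_trans _ kt)//.
    by rewrite ler_pM2r// ler_nat.
  exists (Ordinal kK); split=> /=; first exact: ltW.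
  by apply/negP; rewrite -ltNge.
Qed.

Lemma TM_dist_le (s t : T) (eps : R) (K : nat) :
  is_TM_process P X theta -> 0 < eps -> (0 < K)%N ->
  fine (P [set w | eps < `|X s w - X t w|]) <= 2 * ((K%:R * eps)^-1 +
    \sum_(k < K) (expR (- (k.+1%:R * eps)^-1) -
                  expR (- (theta [fset s; t]%fset / (k.+1%:R * eps))))).
Proof.
move=> TMX e0 K0; rewrite -lee_fin fineK; last first.
  by apply: fin_num_measure; exact: measurable_dist_gt.
apply: (@le_trans _ _
  (P ([set w | X s w + eps < X t w] `|` [set w | X t w + eps < X s w]))).
  apply: le_measure; rewrite ?inE; first exact: measurable_dist_gt.
    by apply: measurableU; exact: measurable_increment.
  by move=> w /=; rewrite ltr_normr => /orP[] H; [right|left]; lra.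
apply: le_trans (measureU2 _ _ _) _; try exact: measurable_increment.
rewrite mulr_natl mulr2n EFinD leeD//; first exact: TM_increment_le.
by rewrite fsetUC; exact: TM_increment_le.
Qed.

End StochasticContinuity.

(** * Limits of pair coefficients and stochastic continuity on a metric space *)

Section Equivalence.
Context (R : realType) (T : metricType R) (d : measure_display)
  (W : measurableType d) (P : probability W R) (X : T -> {RV P >-> R})
  (theta : {fset T} -> R) (TMX : is_TM_process P X theta).

Lemma ecf_cvg_stochastically_continuous :
  (forall t : T, theta [fset s; t]%fset @[s --> t] --> (1 : R)) ->
  stochastically_continuous P X.
Proof.
move=> H eps t u e0 ut; apply/fine_cvgP; split.
  by apply: nearW => n; apply: fin_num_measure; exact: measurable_dist_gt.
apply/cvgrPdist_le => e ee0.
(* The grid size makes the tail term at most [e / 2] and does not depend on [n], so the remaining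
   finite sum tends to 0 term by term. *)
pose K := (Num.truncn (4 / (e * eps))).+1.
have K0 : (0 < K)%N by [].
have Ke : 2 * (K%:R * eps)^-1 <= e / 2.
  have : 4 / (e * eps) < K%:R by exact: truncnS_gt.
  rewrite ltr_pdivrMr ?mulr_gt0// => /ltW HK.
  rewrite -[X in X <= _]/(2 / (K%:R * eps)) ler_pdivrMr ?mulr_gt0 ?ltr0n//; lra.
pose S n := \sum_(k < K) (expR (- (k.+1%:R * eps)^-1) -
   expR (- (theta [fset u n; t]%fset / (k.+1%:R * eps)))).
have S0 : S n @[n --> \oo] --> (0 : R).
  rewrite [X in _ --> X](_ : 0 = \sum_(k < K) (0 : R)); last by rewrite big1.
  apply: cvg_big; first exact: add_continuous.
  move=> k _; rewrite -(subrr (expR (- (k.+1%:R * eps)^-1))).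
  apply: cvgB; first exact: cvg_cst.
  apply: continuous_cvg; first exact: continuous_expR.
  apply: cvgN; rewrite -[X in _ --> X]mul1r; apply: cvgMl.
  exact: cvg_comp ut (H t).
have e4 : 0 < e / 4 by lra.
move/cvgrPdist_le : S0 => /(_ _ e4); apply: filterS => n.
rewrite sub0r normrN sub0r normrN /= => Sn.
rewrite ger0_norm ?fine_ge0//.
apply: le_trans (TM_dist_le (u n) t TMX e0 K0) _.
have := ler_norm (S n); rewrite -/(S n); lra.
Qed.

(** Stochastic continuity speaks of sequences only, so failure of the limit is turned into a
    sequence of counterexamples in balls of radius 1/(n+1). *)
Lemma stochastically_continuous_ecf_cvg : stochastically_continuous P X ->
  forall t : T, expR (- theta [fset s; t]%fset) @[s --> t] --> expR (-1 : R).
Proof.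
move=> HX t; apply/cvgrPdist_lt => e e0; apply: contrapT => nH.
have /choice[u uP] (n : nat) : exists s : T, ball t n.+1%:R^-1 s /\
    ~ (`|expR (-1) - expR (- theta [fset s; t]%fset)| < e).
  apply: contrapT => /forallNP nu; apply: nH; apply/nbhs_ballP.
  exists n.+1%:R^-1 => /=; first by rewrite invr_gt0.
  by move=> s ts; apply: contrapT => h; exact: (nu s).
have ut : u @ \oo --> t.
  apply/cvg_ballP => r r0; have := near_infty_natSinv_lt (PosNum r0).
  apply: filterS => n /ltW nr; apply: le_ball nr _ _; exact: (uP n).1.
(* [e / 2] serves both as distance threshold and as bound on the probability, the two terms of
   [TM_ecf_le_dist]. *)
have e2 : 0 < e / 2 by lra.
have /fine_cvgP[_ /cvgrPdist_lt/(_ _ e2) Pu] := HX _ _ _ e2 ut.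
have [n] := filter_ex Pu; rewrite sub0r normrN => /(le_lt_trans (ler_norm _)) /= Pn.
apply: (uP n).2; rewrite ger0_norm.
  have := TM_ecf_le_dist (u n) t TMX e2; lra.
rewrite -lee_fin; have := TM_setD_probability (u n) t TMX ltr01.
by rewrite invr1 mulr1 => <-.
Qed.

Lemma expR_ecf_cvg (t : T) : theta [fset s; t]%fset @[s --> t] --> (1 : R) ->
  expR (- theta [fset s; t]%fset) @[s --> t] --> expR (-1 : R).
Proof.
by move=> H; apply: continuous_cvg; [exact: continuous_expR|exact: cvgN].
Qed.

End Equivalence.

Theorem theorem25 (R : realType) (T : metricType R)
    (d : measure_display) (W : measurableType d) (P : probability W R)
    (X : T -> {RV P >-> R}) (theta : {fset T} -> R)
    (hX : is_TM_process P X theta) :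
  [<-> stochastically_continuous P X;
       continuous_set_function theta;
       continuous (fun p : T * T => theta [fset p.1; p.2]%fset);
       forall t : T, {for (t, t),
         continuous (fun p : T * T => theta [fset p.1; p.2]%fset)}].
Proof.
tfae.
- move=> HX m t.
  apply: (@TM_ecf_cvg _ _ _ _ _ X theta nbhs _ _ m (fun i x => x i) t) => //.
  - exact: (@nbhs_filter {ptws 'I_m -> T}).
  - exact: (stochastically_continuous_ecf_cvg hX HX).
  - by move=> i; exact: (@proj_continuous _ (fun=> T) i t).
- move=> Hm p.
  (* Codes the pair as the image of a 2-tuple, so that continuity of the set function at m = 2
     applies. *)
  have th (s t : T) : theta [fset s; t]%fset =
      theta [fset (if i == ord0 then s else t) | i : 'I_2]%fset.
    congr theta; apply/fsetP => x; rewrite !inE; apply/idP/imfsetP => /=.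
      by case/orP => /eqP ->; [exists ord0|exists ord_max].
    by move=> [i _ ->]; case: ifP => _; rewrite eqxx ?orbT.
  have H1 t : theta [fset s; t]%fset @[s --> t] --> (1 : R).
    rewrite -(TM_ecf1 t hX) -[in X in _ --> X](fsetUid [fset t]%fset) th.
    under eq_fun do rewrite th.
    (* Only coordinate 0 of the constant tuple [t] moves, which makes [g] continuous. *)
    pose g (s : T) : {ptws 'I_2 -> T} := fun i => if i == ord0 then s else t.
    have gE : g = @dfwith _ (fun=> T) (fun=> t) ord0.
      apply/funext => s; apply/funext => i; rewrite /g.
      by case: dfwithP => [|j]; rewrite ?eqxx// eq_sym => /negbTE ->.
    have gc : g s @[s --> t] --> g t by rewrite gE; exact: dfwith_continuous.
    exact: (cvg_comp _ _ gc (Hm 2 (g t))).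
  rewrite /continuous_at th; under eq_fun do rewrite th.
  (* The limits at the diagonal in one variable already give continuity at every pair [p]. *)
  apply: (@TM_ecf_cvg _ _ _ _ _ X theta nbhs _ _ 2
    (fun i (q : T * T) => if i == ord0 then q.1 else q.2)) => //.
    by move=> u; exact: expR_ecf_cvg.
  by move=> i; case: ifP => _; [exact: cvg_fst|exact: cvg_snd].
- by move=> H t; exact: H.
- move=> H; apply: (ecf_cvg_stochastically_continuous hX) => t.
  rewrite -(TM_ecf1 t hX) -[in X in _ --> X](fsetUid [fset t]%fset).
  (* Continuity at (t,t) is restricted to the points (s,t), where the limit is theta{t} = 1. *)
  apply: (cvg_comp (fun s : T => (s, t))
    (fun p : T * T => theta [fset p.1; p.2]%fset) _ (H t)).
  by apply: cvg_pair; [exact: cvg_id|exact: cvg_cst].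
Qed.
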